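(* In the Markov-modeled downlink with randomly delayed ARQ feedback described in the context, the greedy policy is not, in general, optimal when there are more than two users. That is, there exist a number of users $N>2$, channel parameters $p>r$, a delay distribution $P_D$, a horizon $m$ and an initial belief vector $\pi_m\in[0,1]^N$ for which some scheduling policy $\{\mathfrak{A}_k\}_{k=1}^m$ satisfies $\eta_{\mathrm{sum}}(m,\{\mathfrak{A}_k\}_{k=1}^m)>\eta_{\mathrm{sum}}(m,\{\widehat{\mathfrak{A}}_k\}_{k=1}^m)$, where $\{\widehat{\mathfrak{A}}_k\}_{k=1}^m$ is the greedy policy.
   Context: Model. There are $N$ users. Time is slotted and slots are indexed in DEcreasing order $m,m-1,\ldots,1$, where $m$ is the horizon (slot $m$ is first, slot $1$ is last). The channel state of user $i$ in slot $t$ is $S_t(i)\in\{0,1\}$ ($1$ = ON, $0$ = OFF). The channels are independent across users, and each is a Markov chain with $P(S_t(i)=1\mid S_{t+1}(i)=1)=p$ and $P(S_t(i)=1\mid S_{t+1}(i)=0)=r$, with $p,r\in[0,1]$ and $p>r$. Initially $P(S_m(i)=1)=\pi_m(i)$. Scheduling and feedback. In each slot $t$ the scheduler, not knowing the channel states, schedules exactly one user $a_t\in\{1,\ldots,N\}$. The scheduled user generates the ARQ feedback bit $f_t=S_t(a_t)$ ($1$=ACK, $0$=NACK), which arrives, without error and stamped with its originating slot, at the end of slot $t-D(a_t,t)$ (delay $0$ means it arrives at the end of slot $t$ itself). The delays $D(i,t)$ are i.i.d. across users and time with probability mass function $P_D$ on $\{0,1,2,\ldots\}$ and independent of the channels.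 Beliefs. Let $T(x)=xp+(1-x)r$, $T^0(x)=x$, $T^u=T\circ T^{u-1}$. The belief $\pi_t(i)$ is the probability that user $i$'s channel is ON in slot $t$ given all feedback that has arrived by the beginning of slot $t$: if $k>t$ is the latest (most recent) slot from which feedback of user $i$ has arrived, then $\pi_t(i)=T^{k-t}(f_k)$; if no feedback of user $i$ has arrived, $\pi_t(i)=T^{m-t}(\pi_m(i))$. Policies and reward. A scheduling policy $\{\mathfrak{A}_k\}_{k=1}^m$ is a family of maps, where $\mathfrak{A}_k$ maps all the information available to the scheduler in slot $k$ (the belief vectors of slots $m,\ldots,k$ as held by the scheduler in slot $k$, and the past decisions $a_m,\ldots,a_{k+1}$) together with $k$ to a decision $a_k$. The expected immediate reward in slot $t$ is $R_t(\pi_t,a_t)=\pi_t(a_t)$; $V_m(\pi_m,\{\mathfrak{A}_k\}_{k=1}^m)$ is the expected total reward $E\big[\sum_{t=1}^m \pi_t(a_t)\big]$ under the policy, and $\eta_{\mathrm{sum}}(m,\{\mathfrak{A}_k\}_{k=1}^m)=V_m(\pi_m,\{\mathfrak{A}_k\}_{k=1}^m)/m$. Greedy policy. $\widehat{\mathfrak{A}}_k$ chooses $\hat a_k=\arg\max_i \pi_k(i)$ (ties broken arbitrarily). *)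

(* Defs.v *)
From mathcomp Require Import all_boot all_order all_algebra.
From mathcomp Require Import all_classical all_reals all_analysis.
Import Order.TTheory GRing.Theory Num.Theory.

Set Implicit Arguments.
Unset Strict Implicit.
Unset Printing Implicit Defensive.

Local Open Scope ring_scope.

(* Slots are numbered m, m-1, ..., 1 in order of time. Every finite sequence
   below (paths, delays, decisions, beliefs) is listed in order of time, so its
   entry for slot t, when it starts in slot m, is the one at position m - t. *)

(* Sample points: for each user, the channel states and the feedback delays in
   slots m, ..., 1. *)
Definition outcome (N m : nat) : Type :=
  ({ffun 'I_N -> m.-tuple bool} * {ffun 'I_N -> m.-tuple nat})%type.

Definition state (N m : nat) (w : outcome N m) (t : nat) (i : 'I_N) : bool :=
  nth false (w.1 i) (m - t).

Definition delay (N m : nat) (w : outcome N m) (i : 'I_N) (t : nat) : nat :=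
  nth 0%N (w.2 i) (m - t).

Definition is_pmf (R : realType) (q : nat -> R) : Prop :=
  (forall d, 0 <= q d) /\ (\sum_(0 <= d <oo) (q d)%:E = 1)%E.

(* Conditional probability P(S_t(i) = b | S_(t+1)(i) = a). *)
Definition trans (R : realType) (p r : R) (a b : bool) : R :=
  bernoulli_pmf (if a then p else r) b.

Definition law (R : realType) (N m : nat) (p r : R) (q : nat -> R)
    (pi : 'rV[R]_N) (w : outcome N m) : R :=
  \prod_(i < N)
    (bernoulli_pmf (pi 0 i) (state w m i) *
     \prod_(1 <= t < m) trans p r (state w t.+1 i) (state w t i) *
     \prod_(1 <= t < m.+1) q (delay w i t)).

(* Only applied to nonnegative X. *)
Definition expect (R : realType) (N m : nat) (p r : R) (q : nat -> R)
    (pi : 'rV[R]_N) (X : outcome N m -> R) : \bar R :=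
  \esum_(w in [set: outcome N m]) (law p r q pi w * X w)%:E.

Definition evolve (R : realType) (p r x : R) : R := x * p + (1 - x) * r.

(* Given past decisions h, the slots after which user i's belief in slot j is
   to be computed, from the latest to the earliest: the slots l > j in which
   user i was scheduled and whose feedback, arriving at the end of slot
   l - delay, is available at the beginning of slot k. *)
Definition received (N m : nat) (w : outcome N m) (h : seq 'I_N)
    (k j : nat) (i : 'I_N) : seq nat :=
  [seq l <- index_iota j.+1 m.+1 |
     (onth h (m - l) == Some i) && (k < l - delay w i l)%N].

(* Belief vector of slot j as held at the beginning of slot k <= j; feedback
   that arrives late revises the beliefs of past slots. *)
Definition belief (R : realType) (N m : nat) (p r : R) (pi : 'rV[R]_N)
    (w : outcome N m) (h : seq 'I_N) (k j : nat) : 'rV[R]_N :=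
  \row_i if received w h k j i is l :: _
         then iter (l - j) (evolve p r) (state w l i)%:R
         else iter (m - j) (evolve p r) (pi 0 i).

Definition beliefs (R : realType) (N m : nat) (p r : R) (pi : 'rV[R]_N)
    (w : outcome N m) (h : seq 'I_N) (k : nat) : seq 'rV[R]_N :=
  [seq belief p r pi w h k j | j <- rev (index_iota k m.+1)].

(* A k bs h is the user scheduled in slot k when bs are the belief vectors of
   slots m, ..., k and h the decisions made in slots m, ..., k+1. *)
Definition policy (R : realType) (N : nat) : Type :=
  nat -> seq 'rV[R]_N -> seq 'I_N -> 'I_N.

(* The last entry of bs is the belief vector of the current slot; ties may be
   broken in any way, possibly depending on k, bs and h. *)
Definition greedy (R : realType) (N : nat) (A : policy R N) : Prop :=
  forall k (bs : seq 'rV[R]_N) h i, last 0 bs 0 i <= last 0 bs 0 (A k bs h).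

(* The decisions of the first n slots m, ..., m-n+1. *)
Fixpoint decisions (R : realType) (N m : nat) (p r : R) (pi : 'rV[R]_N)
    (A : policy R N) (w : outcome N m) (n : nat) : seq 'I_N :=
  if n is n'.+1 then
    let h := decisions p r pi A w n' in
    rcons h (A (m - n')%N (beliefs p r pi w h (m - n')) h)
  else [::].

Definition reward (R : realType) (N m : nat) (p r : R) (pi : 'rV[R]_N)
    (A : policy R N) (w : outcome N m) (t : nat) : R :=
  let h := decisions p r pi A w (m - t) in
  let bs := beliefs p r pi w h t in
  belief p r pi w h t t 0 (A t bs h).

Definition total_reward (R : realType) (N m : nat) (p r : R) (q : nat -> R)
    (pi : 'rV[R]_N) (A : policy R N) : R :=
  fine (expect p r q pi
    (fun w : outcome N m => \sum_(1 <= t < m.+1) reward p r pi A w t)).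

Definition eta_sum (R : realType) (N m : nat) (p r : R) (q : nat -> R)
    (pi : 'rV[R]_N) (A : policy R N) : R :=
  total_reward m p r q pi A / m%:R.

(* Main.v *)
Require Import Defs.
From mathcomp Require Import all_boot all_order all_algebra.
From mathcomp Require Import all_classical all_reals all_analysis.
From mathcomp Require Import zify lra.
Import Order.TTheory GRing.Theory Num.Theory.
Local Open Scope ring_scope.

(** Take p = 1 and r = 0, so that every channel keeps its initial state, and let
    each feedback bit arrive exactly one slot late. With three users,
    pi = (1/2, 2/5, 2/5) and horizon 4, no feedback is available in the first
    two slots, hence the greedy policy schedules user 0 twice and the second
    transmission teaches it nothing: its total reward is
    1/2 + 1/2 + 7/10 + 7/10 = 12/5. Scheduling user 1 in the second slot costs
    1/10 there, but if user 0 turns out OFF and user 1 ON, the last slot earns 1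
    instead of 2/5; this happens with probability 1/5, and the net gain is
    3/5 * 1/5 - 1/10 = 1/50. (With only two users there is nothing to learn from
    user 1, who would be scheduled anyway when user 0 is OFF.) *)

(** * Frozen channels and constant delays *)

Definition const_delay (R : realType) (d : nat) : nat -> R :=
  fun n => (n == d)%:R.

Lemma const_delay_pmf (R : realType) (d : nat) : is_pmf (const_delay R d).
Proof.
split=> [n|]; first exact: ler0n.
rewrite nneseries_esumT; last by move=> n; rewrite lee_fin ler0n.
rewrite -[RHS](@esum_set1 R nat d (fun=> 1%E)) ?lee01 // [RHS]esum_mkcond.
apply: eq_esum => n _; rewrite /const_delay.
case: (eqVneq n d) => [->|nd]; first by rewrite mem_set.
by rewrite memNset // => /= /eqP; rewrite (negPf nd).
Qed.

Lemma esum_finType (R : realType) (T : finType) (a : T -> \bar R) :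
  (forall x, 0 <= a x)%E ->
  \esum_(x in [set: T]) a x = (\sum_(x : T) a x)%E.
Proof.
move=> a0; rewrite esum_fset //; last exact: finite_finset.
rewrite (_ : [set: T]%classic = [set` index_enum T]%classic); last first.
  by apply/seteqP; split=> x //= _; rewrite mem_index_enum.
by rewrite -fsbig_seq // index_enum_uniq.
Qed.

Definition static_outcome {N : nat} (m d : nat) (s : 'I_N -> bool) : outcome N m :=
  ([ffun i => nseq_tuple m (s i)], [ffun=> nseq_tuple m d]).

Lemma state_static (N m d : nat) (s : 'I_N -> bool) t i :
  (0 < t <= m)%N -> state (static_outcome m d s) t i = s i.
Proof. by move=> tm; rewrite /state ffunE nth_nseq ifT //; lia. Qed.

Lemma delay_static (N m d : nat) (s : 'I_N -> bool) t i :
  (0 < t <= m)%N -> delay (static_outcome m d s) i t = d.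
Proof. by move=> tm; rewrite /delay ffunE nth_nseq ifT //; lia. Qed.

Lemma trans_static (R : realType) (a b : bool) :
  trans (1 : R) 0 a b = (a == b)%:R.
Proof. by case: a; case: b; rewrite /trans /bernoulli_pmf ?subrr ?subr0. Qed.

Lemma law_static (R : realType) (N m d : nat) (pi : 'rV[R]_N) (s : 'I_N -> bool) :
  law 1 0 (const_delay R d) pi (static_outcome m.+1 d s) =
  \prod_(i < N) bernoulli_pmf (pi 0 i) (s i).
Proof.
apply: eq_bigr => i _; rewrite state_static ?leqnn // big_nat big1 => [|t tm].
  rewrite mulr1 big_nat big1 ?mulr1 // => t tm.
  by rewrite delay_static // /const_delay eqxx.
by rewrite !state_static ?trans_static ?eqxx //; lia.
Qed.

(** A state change, or a delay other than [d], puts a zero factor into [law]. *)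
Lemma law_support (R : realType) (N m d : nat) (pi : 'rV[R]_N) (w : outcome N m) :
  law 1 0 (const_delay R d) pi w != 0 ->
  w = static_outcome m d (state w m).
Proof.
move=> w0.
have stateE i j : (j < m)%N -> state w (m - j) i = state w m i.
  elim: j => [|j IH] jm; first by rewrite subn0.
  rewrite -IH; last exact: ltnW.
  apply/eqP; apply: contra_neqT w0 => ne.
  rewrite /law (bigD1 i) //= [\prod_(1 <= t < m) _](bigD1_seq (m - j.+1)%N) /=.
  - rewrite (_ : (m - j.+1).+1 = m - j)%N; last lia.
    by rewrite trans_static eq_sym (negPf ne) !(mul0r, mulr0).
  - by rewrite mem_index_iota; lia.
  - exact: iota_uniq.
have delayE i j : (j < m)%N -> delay w i (m - j) = d.
  move=> jm; apply/eqP; apply: contra_neqT w0 => ne.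
  rewrite /law (bigD1 i) //= [\prod_(1 <= t < m.+1) _](bigD1_seq (m - j)%N) /=.
  - by rewrite /const_delay (negPf ne) !(mul0r, mulr0).
  - by rewrite mem_index_iota; lia.
  - exact: iota_uniq.
case: w w0 stateE delayE => w1 w2 _ stateE delayE; congr pair;
  apply/ffunP => i; rewrite ffunE; apply/val_inj.
- apply: (@eq_from_nth _ false) => [|j]; rewrite !size_tuple // => jm.
  rewrite nth_nseq jm -(stateE i j) // /state /=; congr nth; lia.
- apply: (@eq_from_nth _ 0%N) => [|j]; rewrite !size_tuple // => jm.
  rewrite nth_nseq jm -(delayE i j) // /delay /=; congr nth; lia.
Qed.

(** The sample space is infinite because delays are unbounded, but [law] vanishes outside the static
    outcomes, and these are indexed injectively by the states in the initial slot. *)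
Lemma expect_static (R : realType) (N m d : nat) (pi : 'rV[R]_N)
    (X : outcome N m.+1 -> R) :
  (forall i, 0 <= pi 0 i <= 1) -> (forall s, 0 <= X (static_outcome m.+1 d s)) ->
  expect 1 0 (const_delay R d) pi X =
  (\sum_(s : {ffun 'I_N -> bool})
     (\prod_(i < N) bernoulli_pmf (pi 0 i) (s i)) *
       X (static_outcome m.+1 d s))%:E.
Proof.
move=> pi01 X0; set so := fun s : {ffun 'I_N -> bool} => static_outcome m.+1 d s.
have so_inj : set_inj [set: {ffun 'I_N -> bool}]%classic so.
  move=> s s' _ _ ss'; apply/ffunP => i.
  by rewrite -(state_static N m.+1 d s m.+1) ?leqnn // -/(so s) ss' state_static ?leqnn.
transitivity (\esum_(w in range so) (law 1 0 (const_delay R d) pi w * X w)%:E).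
  rewrite [RHS]esum_mkcond; apply: eq_esum => w _.
  case: ifPn => // /negP wso.
  have [->|/law_support ws] := eqVneq (law 1 0 (const_delay R d) pi w) 0.
    by rewrite mul0r.
  exfalso; apply: wso; rewrite inE; exists [ffun i => state w m.+1 i] => //.
  rewrite [RHS]ws /so /static_outcome; congr pair.
  by apply/ffunP => i; rewrite !ffunE.
rewrite (@esum_image R {ffun 'I_N -> bool} (outcome N m.+1)) //.
rewrite (@esum_finType R {ffun 'I_N -> bool}) => [|s].
  by rewrite -sumEFin; apply: eq_bigr => s _; rewrite law_static.
rewrite lee_fin law_static mulr_ge0 ?X0 // prodr_ge0 // => i _.
exact: bernoulli_pmf_ge0.
Qed.

(** * Beliefs, greedy rewards and averages over independent states *)

(** A frozen channel is revealed by feedback of any age. Feedback of slot [l] is available in slot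
    [k] iff [k + d < l], that is, iff its position [m - l] lies in the prefix of length
    [m - (k + d)]. *)
Lemma belief_static (R : realType) (N m d k : nat) (pi : 'rV[R]_N)
    (s : 'I_N -> bool) (h : seq 'I_N) i :
  (0 < k)%N ->
  belief 1 0 pi (static_outcome m d s) h k k 0 i =
  if i \in take (m - (k + d)) h then (s i)%:R else pi 0 i.
Proof.
move=> k0.
have evolve_id n (x : R) : iter n (evolve 1 0) x = x.
  by elim: n => //= n ->; rewrite /evolve mulr1 mulr0 addr0.
rewrite mxE; set r := received _ _ _ _ _.
have memr l : (l \in r) =
    [&& (k < l <= m)%N, onth h (m - l) == Some i & (k < l - d)%N].
  rewrite mem_filter mem_index_iota andbC ltnS.
  case: (boolP (k < l <= m)%N) => //= lm.
  by rewrite delay_static //; lia.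
have onth_take n j : onth (take n h) j = if (j < n)%N then onth h j else None.
  case: ltnP => jn; first by rewrite !onthE map_take nth_take.
  by rewrite onth_default // size_take_min geq_min jn.
case: (boolP (i \in _)) => [/onthP[j]|/onthPn ni].
- rewrite onth_take; case: ltnP => // jm hj.
  have : (m - j)%N \in r.
    by rewrite memr subKn ?hj ?eqxx /=; lia.
  case: r memr => // l r' memr _.
  rewrite evolve_id state_static //.
  have := mem_head l r'; rewrite memr; lia.
- case: r memr => [|l r'] memr; first exact: evolve_id.
  have := mem_head l r'; rewrite memr => /and3P[lm hl kl].
  have := ni (m - l)%N; rewrite onth_take ifT ?(eqP hl) ?eqxx //; lia.
Qed.

Lemma last_beliefs (R : realType) (N m : nat) (p r : R) (pi : 'rV[R]_N)
    (w : outcome N m) (h : seq 'I_N) k :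
  (k <= m)%N -> last 0 (beliefs p r pi w h k) = belief p r pi w h k k.
Proof.
move=> km; rewrite /beliefs /index_iota subSn //= rev_cons map_rcons.
by rewrite last_rcons.
Qed.

(** Stated for one slot, so that it also covers a policy that deviates from greedy in slot 3
    alone. *)
Definition greedy_at {R : realType} {N : nat} (A : policy R N) (k : nat) : Prop :=
  forall (bs : seq 'rV[R]_N) h i, last 0 bs 0 i <= last 0 bs 0 (A k bs h).

(** All maximizers share the same belief, so the reward can be read off at any chosen maximizer [j],
    however ties are broken. *)
Lemma reward_greedy (R : realType) (N m t : nat) (p r : R) (pi : 'rV[R]_N)
    (A : policy R N) (w : outcome N m) j :
  let b := belief p r pi w (decisions p r pi A w (m - t)) t t in
  (t <= m)%N -> greedy_at A t -> (forall i, b 0 i <= b 0 j) ->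
  reward p r pi A w t = b 0 j.
Proof.
move=> /= tm At bj; apply/le_anti; rewrite {1}/reward /= bj /=.
by have := At (beliefs p r pi w (decisions p r pi A w (m - t)) t)
  (decisions p r pi A w (m - t)) j; rewrite last_beliefs.
Qed.

(** Independence of the users: the mean of a product is the product of the means. *)
Lemma sum_bernoulli_prod (R : realType) (N : nat) (pi : 'rV[R]_N)
    (g : 'I_N -> bool -> R) :
  \sum_(s : {ffun 'I_N -> bool})
    (\prod_(i < N) bernoulli_pmf (pi 0 i) (s i)) * \prod_(i < N) g i (s i) =
  \prod_(i < N) (pi 0 i * g i true + (1 - pi 0 i) * g i false).
Proof.
under eq_bigr do rewrite -big_split /=.
rewrite -(bigA_distr_bigA (fun i b => bernoulli_pmf (pi 0 i) b * g i b)).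
by apply: eq_bigr => i _; rewrite big_bool.
Qed.

(** * The instance with three users and horizon 4 *)

Definition prior (R : realType) : 'rV[R]_3 :=
  \row_i if i == 0 then 2^-1 else 2 / 5.

(** Slot 2 knows only the state of user 0, scheduled in slot 4; slot 1 also knows that of [j],
    scheduled in slot 3. Both policies to be compared fit, with [j] equal to 0 or 1. *)
Lemma rewards_static (R : realType) (A : policy R 3) (s : 'I_3 -> bool) (j : 'I_3) :
  let w := static_outcome 4 1 s in
  greedy_at A 4 -> greedy_at A 2 -> greedy_at A 1 ->
  A 3%N (beliefs 1 0 (prior R) w [:: 0] 3) [:: 0] = j -> j != 2 ->
  \sum_(1 <= t < 5) reward 1 0 (prior R) A w t =
  2^-1 + prior R 0 j + (if s 0 then 1 else 2 / 5)
  + (if s 0 || ((j == 1) && s 1) then 1 else 2 / 5).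
Proof.
move=> w A4 A2 A1 A3 j2.
have I3 (i : 'I_3) : [|| i == 0, i == 1 | i == 2] by case: i => [[|[|[|]]]].
have b4 h i : belief 1 0 (prior R) w h 4 4 0 i = prior R 0 i.
  by rewrite belief_static // take0.
have b3 h i : belief 1 0 (prior R) w h 3 3 0 i = prior R 0 i.
  by rewrite belief_static // take0.
have a4 : A 4%N (beliefs 1 0 (prior R) w [::] 4) [::] = 0.
  have := A4 (beliefs 1 0 (prior R) w [::] 4) [::] 0.
  rewrite last_beliefs // !b4 !mxE eqxx; case: (A 4%N _ _ =P 0) => // _ h.
  by clear -h; exfalso; lra.
have d1 : decisions 1 0 (prior R) A w 1 = [:: 0] by rewrite /= a4.
have d2 : decisions 1 0 (prior R) A w 2 = [:: 0; j] by rewrite /= a4 /= A3.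
have sumE (F : nat -> R) : \sum_(1 <= t < 5) F t = F 1%N + (F 2%N + (F 3%N + F 4%N)).
  by do 4 rewrite big_ltn //; rewrite big_geq // addr0.
have r4 : reward 1 0 (prior R) A w 4 = 2^-1.
  by rewrite /reward /= a4 b4 mxE eqxx.
have r3 : reward 1 0 (prior R) A w 3 = prior R 0 j.
  by rewrite /reward subSnn d1 A3 b3.
have b2 i : belief 1 0 (prior R) w (decisions 1 0 (prior R) A w (4 - 2)) 2 2 0 i =
    if i == 0 then (s i)%:R else prior R 0 i.
  by rewrite belief_static // [decisions _ _ _ _ _ _]d2 /= inE.
have b1 i : belief 1 0 (prior R) w (decisions 1 0 (prior R) A w (4 - 1)) 1 1 0 i =
    if i \in [:: 0; j] then (s i)%:R else prior R 0 i.
  rewrite belief_static //; congr (if _ then _ else _).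
  by rewrite -d2 /= /take.
have r2 : reward 1 0 (prior R) A w 2 = if s 0 then 1 else 2 / 5.
  rewrite (@reward_greedy _ _ _ _ _ _ _ _ _ (if s 0 then 0 else 1)) //.
    by rewrite b2; case s0: (s 0); rewrite ?eqxx ?s0 //= mxE.
  move=> i; rewrite !b2 !mxE ?mulrb {A4 A2 A1 A3 j2}.
  by case/or3P: (I3 i) => /eqP->; case s0: (s 0); rewrite /= ?s0; lra.
have r1 : reward 1 0 (prior R) A w 1 =
    if s 0 || ((j == 1) && s 1) then 1 else 2 / 5.
  (* A maximizer in slot 1: user 0 if ON; otherwise user 1, unless it is known to be OFF, which
     leaves user 2 at its prior [2 / 5]. *)
  rewrite (@reward_greedy _ _ _ _ _ _ _ _ _
    (if s 0 then 0 else if (j == 1) && ~~ s 1 then 2 else 1)) //.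
    rewrite b1; case/or3P: (I3 j) j2 => /eqP-> // _; rewrite !inE.
      by case s0: (s 0); rewrite ?s0 //= mxE.
    by case s0: (s 0); case s1: (s 1); rewrite ?s0 ?s1 //= mxE.
  move=> i; rewrite !b1 !mxE ?mulrb {b1 d2 r3 A4 A2 A1 A3}.
  case/or3P: (I3 j) j2 => /eqP-> // _; case/or3P: (I3 i) => /eqP->;
    by case s0: (s 0); case s1: (s 1); rewrite !inE /= ?s0 ?s1; lra.
rewrite sumE r1 r2 r3 r4 [LHS]addrC [X in X + _ = _]addrC.
by rewrite [X in X + _ + _ = _]addrC.
Qed.

Definition probing_policy (R : realType) : policy R 3 := fun k bs _ =>
  if k == 3%N then 1 else [arg max_(i > (0 : 'I_3)) last 0 bs 0 i]%O.

Lemma probing_policy_greedy (R : realType) k :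
  k != 3%N -> greedy_at (probing_policy R) k.
Proof.
move=> k3 bs h i; rewrite /probing_policy (negPf k3).
by case: Order.TotalTheory.arg_maxP => // j _; exact.
Qed.

(** The slot 3 decision can be required to be the same for all [s], since no feedback has arrived by
    then. *)
Lemma total_reward_static (R : realType) (A : policy R 3) (j : 'I_3) :
  greedy_at A 4 -> greedy_at A 2 -> greedy_at A 1 ->
  (forall s : 'I_3 -> bool,
     A 3%N (beliefs 1 0 (prior R) (static_outcome 4 1 s) [:: 0] 3) [:: 0] = j) ->
  j != 2 ->
  total_reward 4 1 0 (const_delay R 1) (prior R) A =
  \sum_(s : {ffun 'I_3 -> bool})
    (\prod_(i < 3) bernoulli_pmf (prior R 0 i) (s i)) *
    (2^-1 + prior R 0 j + (if s 0 then 1 else 2 / 5)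
     + (if s 0 || ((j == 1) && s 1) then 1 else 2 / 5)).
Proof.
move=> A4 A2 A1 A3 j2.
have prior01 i : 0 <= prior R 0 i <= 1.
  by rewrite mxE; case: ifP => _; clear; lra.
rewrite /total_reward expect_static //=.
  by apply: eq_bigr => s _; rewrite (rewards_static _ _ _ _ A4 A2 A1 (A3 s) j2).
move=> s; rewrite (rewards_static _ _ _ _ A4 A2 A1 (A3 s) j2).
have /andP[pj _] := prior01 j; case: (s 0); case: (_ && _) => /=;
  by clear -pj; lra.
Qed.

Theorem proposition5 (R : realType) :
  exists (N : nat) (p r : R) (q : nat -> R) (m : nat) (pi : 'rV[R]_N),
    [/\ (2 < N)%N, 0 <= r, r < p, p <= 1 & is_pmf q] /\
    (forall i, 0 <= pi 0 i <= 1) /\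
    exists A : policy R N,
      forall G : policy R N, greedy G ->
        eta_sum m p r q pi G < eta_sum m p r q pi A.
Proof.
exists 3%N, 1, 0, (const_delay R 1), 4%N, (prior R).
split; first by split; rewrite ?ler01 ?ltr01 //; exact: const_delay_pmf.
split; first by move=> i; rewrite mxE; case: ifP => _; lra.
exists (probing_policy R) => G gG.
(* User 0 is the strict maximizer of the prior, so no tie-breaking rule can change this choice. *)
have G3 s : G 3%N (beliefs 1 0 (prior R) (static_outcome 4 1 s) [:: 0] 3) [:: 0] = 0.
  have := gG 3%N (beliefs 1 0 (prior R) (static_outcome 4 1 s) [:: 0] 3) [:: 0] 0.
  rewrite last_beliefs // !belief_static // !take0 !mxE eqxx /=.
  by case: (G _ _ _ =P 0) => // _ h; clear -h; exfalso; lra.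
rewrite /eta_sum ltr_pM2r ?invr_gt0 ?ltr0n //.
rewrite (total_reward_static _ _ _ (gG 4%N) (gG 2%N) (gG 1%N) G3) //.
rewrite (@total_reward_static R (probing_policy R) 1) //;
  try exact: probing_policy_greedy.
rewrite -subr_gt0 -sumrB.
under eq_bigr => s _ do rewrite -mulrBr.
(* The product of the [g i (s i)] is the indicator of user 0 OFF and user 1 ON, the event in which
   probing pays off. *)
pose g (i : 'I_3) (b : bool) : R :=
  if i == 0 then (~~ b)%:R else if i == 1 then b%:R else 1.
have diffE (s : {ffun 'I_3 -> bool}) :
    2^-1 + prior R 0 1 + (if s 0 then 1 else 2 / 5)
      + (if s 0 || ((1 == 1 :> 'I_3) && s 1) then 1 else 2 / 5)
    - (2^-1 + prior R 0 0 + (if s 0 then 1 else 2 / 5)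
      + (if s 0 || ((0 == 1 :> 'I_3) && s 1) then 1 else 2 / 5))
    (* The constant is written as a product too, so that [sum_bernoulli_prod] evaluates both
       terms. *)
    = 3 / 5 * \prod_(i < 3) g i (s i) - 10^-1 * \prod_(i < 3) 1.
  rewrite !big_ord_recl !big_ord0 /g !mxE /= (_ : lift ord0 ord0 = 1); last exact/val_inj.
  by case: (s 0); case: (s 1) => /=; clear; lra.
under eq_bigr => s _ do rewrite diffE mulrBr !(mulrCA _ (_ / _)) (mulrCA _ 10^-1).
rewrite sumrB -!mulr_sumr (sum_bernoulli_prod _ _ _ g)
  (sum_bernoulli_prod _ _ _ (fun _ _ => 1)).
rewrite !big_ord_recl !big_ord0 /g !mxE /=; clear; lra.
Qed.
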